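(* Let $A$ be a meet-semilattice. The collection of frames with S-base $A$ coincides with the interval $[D_\infty A,\mathcal{D}A]$ in the coframe of sublocales of $\mathcal{D}A$. That is, under the identifications described in the context: every sublocale $L$ of $\mathcal{D}A$ with $D_\infty A\subseteq L\subseteq \mathcal{D}A$ is a frame having $A$ as an S-base ($D_\infty A$ itself being a sublocale of $\mathcal{D}A$), and every frame $L$ with S-base $A$, regarded as a sublocale of $\mathcal{D}A$, satisfies $D_\infty A\subseteq L\subseteq\mathcal{D}A$.
   Context: A meet-semilattice is a poset with binary meets (not necessarily bounded); morphisms preserve binary meets. A subset $A$ of a frame $L$ is a base if every element of $L$ is a join of elements of $A$; it is an S-base if it is a base and the embedding $A\hookrightarrow L$ is a meet-semilattice morphism (binary meets in $A$ agree with those in $L$). $\mathcal{D}A$ is the frame of all downsets of $A$ (including $\varnothing$) ordered by inclusion. $A$ is identified with its image $\{{\downarrow}a : a\in A\}$ in $\mathcal{D}A$. If $A$ is an S-base of a frame $L$, then $L$ is identified with its isomorphic copy in $\mathcal{D}A$, i.e. with the sublocale $\{\{a\in A: a\le x\}: x\in L\}$ of $\mathcal{D}A$. Sublocales are ordered by inclusion. A subset $G\subseteq A$ is admissible if $\bigvee G$ exists in $A$ and for each $a\in A$ the join $\bigvee\{a\wedge y: y\in G\}$ also exists in $A$ and equals $a\wedge\bigvee G$. A downset $E$ of $A$ is a D-ideal if $\bigvee G\in E$ for each admissible subset $G$ of $E$. $D_\infty A$ is the set of D-ideals of $A$, ordered by inclusion. *)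

(* Defs.v *)
From HB Require Import structures.
From mathcomp Require Import all_boot all_order.
From mathcomp Require Import boolp classical_sets.

Set Implicit Arguments.
Unset Strict Implicit.
Unset Printing Implicit Defensive.

Import Order.Theory.
Local Open Scope classical_set_scope.
Local Open Scope order_scope.

(* Joins and meets of arbitrary subsets are relational: [supremums G s] and
   [infimums G m] say that s is the least upper bound and m the greatest lower
   bound of G. *)

Section Frames.
Context {d : Order.disp_t} (L : porderType d).
Implicit Types (G B S : set L) (x y z m s w : L).

(* Binary meets exist because a poset with all joins has all meets. *)
Definition is_frame : Prop :=
  (forall G, exists s, supremums G s) /\
  (forall x G s m, supremums G s -> infimums [set x; s] m ->
     supremums [set z | exists2 y, G y & infimums [set x; y] z] m).

(* w is the Heyting implication x -> y: z <= w iff z `&` x <= y. *)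
Definition is_implication x y w : Prop :=
  forall z, z <= w <-> exists2 m, infimums [set z; x] m & m <= y.

Definition is_sublocale S : Prop :=
  (forall G m, G `<=` S -> infimums G m -> S m) /\
  (forall x s w, S s -> is_implication x s w -> S w).

Definition sublocale_interval (S1 S2 : set L) : set (set L) :=
  [set S | [/\ is_sublocale S, S1 `<=` S & S `<=` S2]].

Definition is_base B : Prop :=
  forall x, exists2 G, G `<=` B & supremums G x.

Record subposet S := Subposet { subposet_val : L; _ : subposet_val \in S }.

HB.instance Definition _ S := [isSub for @subposet_val S].
HB.instance Definition _ S := [Choice of subposet S by <:].
HB.instance Definition _ S := [SubChoice_isSubPOrder of subposet S by <: with d].

End Frames.

(* The subset A of L is given as a poset A with an order embedding into L. *)
Definition is_Sbase {d d' : Order.disp_t} (A : meetSemilatticeType d)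
    (L : porderType d') (e : A -> L) : Prop :=
  [/\ forall a b, (e a <= e b) = (a <= b),
      is_base (range e) &
      forall a b, infimums [set e a; e b] (e (a `&` b))].

Section Downsets.
Context {d : Order.disp_t} (A : meetSemilatticeType d).
Implicit Types (a b : A) (G : set A).

Definition is_downset (U : set A) : Prop := forall a b, a <= b -> U b -> U a.

Record downsets := Downset { downset_val : set A; _ : `[< is_downset downset_val >] }.

HB.instance Definition _ := [isSub for downset_val].
HB.instance Definition _ := [Choice of downsets by <:].
HB.instance Definition _ := [SubChoice_isSubPOrder of downsets by <: with set_display].

Implicit Types U V : downsets.

Lemma downsetP U : is_downset (val U).
Proof. exact/asboolP/(valP U). Qed.

Lemma downsets_leP U V : (U <= V) <-> (val U `<=` val V).
Proof. by rewrite -subsetEset -leEsub. Qed.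

Lemma is_downset_principal a : `[< is_downset [set b | b <= a] >].
Proof. by apply/asboolP => b c bc /=; apply: le_trans. Qed.

Definition principal a : downsets := Sub [set b | b <= a] (is_downset_principal a).

Definition admissible G : Prop :=
  exists2 s, supremums G s &
    forall a, supremums [set a `&` y | y in G] (a `&` s).

(* The join of an admissible set G is the only s with [supremums G s]. *)
Definition is_Dideal (U : set A) : Prop :=
  is_downset U /\
  forall G s, admissible G -> G `<=` U -> supremums G s -> U s.

Definition D_infty : set downsets := [set U | is_Dideal (val U)].

Lemma is_downset_bigcup (F : set downsets) :
  `[< is_downset (\bigcup_(U in F) val U) >].
Proof.
by apply/asboolP => a b ab [U FU Ub]; exists U => //; apply: downsetP ab Ub.
Qed.

Lemma is_downset_setI U V : `[< is_downset (val U `&` val V) >].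
Proof.
apply/asboolP => a b ab [Ub Vb].
by split; [apply: downsetP ab Ub|apply: downsetP ab Vb].
Qed.

Definition downset_join (F : set downsets) : downsets :=
  Sub (\bigcup_(U in F) val U) (is_downset_bigcup F).

Definition downset_meet U V : downsets :=
  Sub (val U `&` val V) (is_downset_setI U V).

Lemma downset_joinP F : supremums F (downset_join F).
Proof.
split=> [U FU|V ubV]; apply/downsets_leP; rewrite SubK; first by move=> a; exists U.
by move=> a [U /ubV/downsets_leP]; apply.
Qed.

Lemma downset_meetP U V : infimums [set U; V] (downset_meet U V).
Proof.
split=> [W [->|->]|W lbW]; apply/downsets_leP; rewrite SubK => a; [by case..|].
by move=> Wa; split; [have /downsets_leP := lbW U (or_introl erefl)
  |have /downsets_leP := lbW V (or_intror erefl)]; apply.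
Qed.

Lemma downsets_frame : is_frame downsets.
Proof.
split=> [F|U F s m Fs Usm]; first by exists (downset_join F); apply: downset_joinP.
have es : s = downset_join F by apply: is_subset1_supremums Fs (downset_joinP F).
have -> : m = downset_meet U s by apply: is_subset1_infimums Usm (downset_meetP U s).
rewrite es; split=> [W [V FV UVW]|W ubW]; apply/downsets_leP; rewrite !SubK.
  have -> : W = downset_meet U V by apply: is_subset1_infimums UVW (downset_meetP U V).
  by rewrite SubK => a [Ua Va]; split=> //; exists V.
move=> a [Ua [V FV Va]].
have /ubW/downsets_leP : [set z | exists2 y, F y & infimums [set U; y] z] (downset_meet U V)
  by exists V => //; apply: downset_meetP.
by rewrite SubK; apply.
Qed.

End Downsets.

Section Copy.
Context {d d' : Order.disp_t} (A : meetSemilatticeType d) (L : porderType d')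
  (e : A -> L) (Se : is_Sbase e).

Lemma is_downset_trace (x : L) : `[< is_downset [set a | e a <= x] >].
Proof.
apply/asboolP => a b ab /=; apply: le_trans.
by case: Se => ->.
Qed.

(* [trace] is the identification of L with a subset of [downsets A]: it is an
   order embedding ([trace_le]) carrying the copy of A in L to the principal
   downsets ([trace_principal]). By [copy_subposet] below, a subset of
   [downsets A] with S-base the principal downsets is its own copy. *)
Definition trace (x : L) : downsets A :=
  Sub [set a | e a <= x] (is_downset_trace x).

Definition copy : set (downsets A) := range trace.

Lemma trace_le (x y : L) : (trace x <= trace y) = (x <= y).
Proof.
apply/idP/idP => [/downsets_leP|xy]; last first.
  by apply/downsets_leP; rewrite !SubK => a /= /le_trans; apply.
rewrite !SubK => txy; case: Se => _ /(_ x)[G Ge [ubx lubx]] _.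
apply: lubx => z Gz; have [a _ eaz] := Ge _ Gz; rewrite -eaz.
by apply: txy; rewrite /= eaz; apply: ubx.
Qed.

Lemma trace_principal (a : A) : trace (e a) = principal a.
Proof.
apply: val_inj; rewrite !SubK; apply/seteqP.
by case: Se => ele _ _; split=> b /=; rewrite ele.
Qed.

End Copy.

Lemma copy_subposet {d : Order.disp_t} (A : meetSemilatticeType d)
    (S : set (downsets A)) (e : A -> subposet S) (Se : is_Sbase e) :
  (forall a, val (e a) = principal a) -> copy Se = S.
Proof.
move=> ve; have tr x : trace Se x = val x.
  apply: val_inj; rewrite SubK; apply/seteqP; split=> a /=.
    rewrite leEsub ve => /downsets_leP; apply.
    by rewrite SubK /=.
  move=> xa; rewrite leEsub ve; apply/downsets_leP.
  by rewrite SubK => b /= ba; apply: downsetP ba xa.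
apply/seteqP; split=> [U [x _ <-]|U SU]; first by rewrite tr; apply/set_mem/(valP x).
by exists (Sub U (mem_set SU)) => //; rewrite tr SubK.
Qed.

(* Main.v *)
Require Import Defs.
From mathcomp Require Import all_boot all_order.
From mathcomp Require Import boolp classical_sets.

(** A downset [U] contains [a] exactly when [principal a <= U], so membership
in an infimum or an implication of downsets can be read off from their
universal properties.

[D_infty] is a sublocale because multiplying an admissible set by a fixed
element gives an admissible set again ([admissible_meet]): if [V] is a D-ideal,
[G] is admissible and contained in the implication [U -> V], with join [s], and
[b <= s] lies in [U], then [b] is the join of the admissible set of the
[b `&` y], [y] in [G], all of which lie in [V].

A sublocale [S] of a frame is a frame ([sublocale_frame]): joins in [S] are
meets of upper bounds, and distributivity holds because [S] is closed under
implications.  When [S] contains [D_infty] it contains the principal downsets,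
which are D-ideals; they form an S-base of [S] since each downset is the union
of the principal downsets below it.

Conversely let [L] be a frame with S-base [e : A -> L].  The trace map preserves
meets, and for a downset [V] with join [v] in [L] the implication from [V] to
[trace y] is the trace of [v -> y], by distributivity; so [copy Se] is a
sublocale ([copy_sublocale]).  Finally a D-ideal [U] with join [x] in [L] is
the trace of [x] ([Dideal_copy]): if [e a <= x], distributivity makes [a] the
join in [A] of the admissible set of the [a `&` b], [b] in [U], so that [a]
lies in [U]. *)

Import Order.Theory.
Local Open Scope classical_set_scope.
Local Open Scope order_scope.

(** * Bounds, meets and implications in a frame *)

Section Bounds.
Context {d : Order.disp_t} {L : porderType d}.
Implicit Types (G : set L) (x y z m s w : L).

Lemma supremumsP G s :
  supremums G s <-> forall z, s <= z <-> (forall y, G y -> y <= z).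
Proof.
split=> [[ubs lubs] z|sP].
  split=> [sz y Gy|ubz]; first exact: le_trans (ubs y Gy) sz.
  exact: lubs.
by split=> [y Gy|z ubz]; [apply: (sP s).1|apply/sP].
Qed.

Lemma infimumsP G m :
  infimums G m <-> forall z, z <= m <-> (forall y, G y -> z <= y).
Proof.
split=> [[lbm glbm] z|mP].
  split=> [zm y Gy|lbz]; first exact: le_trans zm (lbm y Gy).
  exact: glbm.
by split=> [y Gy|z lbz]; [apply: (mP m).1|apply/mP].
Qed.

Lemma infimums2P x y m :
  infimums [set x; y] m <-> forall z, z <= m <-> z <= x /\ z <= y.
Proof.
rewrite infimumsP; split=> mP z; rewrite mP; split.
- by move=> lbz; split; apply: lbz; [left|right].
- by case=> zx zy _ [->|->].
- by case=> zx zy _ [->|->].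
- by move=> lbz; split; apply: lbz; [left|right].
Qed.

Lemma infimums2C {x y m} : infimums [set x; y] m -> infimums [set y; x] m.
Proof. by rewrite setUC. Qed.

Lemma implication_le {x y w z m} :
  is_implication x y w -> infimums [set z; x] m -> (z <= w <-> m <= y).
Proof.
move=> xyw zxm; split=> [/xyw[k zxk ky]|my]; last by apply/xyw; exists m.
by rewrite (is_subset1_infimums zxm zxk).
Qed.

Hypothesis FL : is_frame L.

Lemma frame_infimum G : exists m, infimums G m.
Proof.
have [m [ubm lubm]] := FL.1 (lbound G); exists m; split=> [y Gy|z lbz].
  by apply: lubm => k; apply.
exact: ubm.
Qed.

Lemma frame_meet x y : exists m, infimums [set x; y] m.
Proof. exact: frame_infimum. Qed.

Lemma frame_meet_sup_le {x G s m} : supremums G s -> infimums [set x; s] m ->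
  forall w, m <= w <->
    (forall y k, G y -> infimums [set x; y] k -> k <= w).
Proof.
move=> Gs xsm w; have /supremumsP -> := FL.2 _ _ _ _ Gs xsm.
split=> [ub y k Gy xyk|ub z [y Gy xyz]]; last exact: ub xyz.
by apply: ub; exists y.
Qed.

Lemma frame_implication x y : exists w, is_implication x y w.
Proof.
have [w wP] := FL.1 [set z | exists2 m, infimums [set z; x] m & m <= y].
exists w => z; split=> [zw|zxy]; last exact: wP.1.
have [m zxm] := frame_meet z x; exists m => //.
have [n xwn] := frame_meet x w; apply: (@le_trans _ _ n).
  have [mz mx] := (iffLR (infimums2P _ _ _) zxm m).1 (lexx m).
  by apply/(iffLR (infimums2P _ _ _) xwn); split=> //; apply: le_trans zw.
apply/(frame_meet_sup_le wP xwn) => u k [k' uxk' k'y] /infimums2C uxk.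
by rewrite (is_subset1_infimums uxk uxk').
Qed.

End Bounds.

(** * Sublocales are frames *)

Section Sublocale.
Context {d : Order.disp_t} {L : porderType d} {S : set L}.
Hypotheses (FL : is_frame L) (subS : is_sublocale S).
Implicit Types (x y z m s w : subposet S) (G : set (subposet S)).

Lemma subposetS x : S (val x).
Proof. exact/set_mem/(valP x). Qed.

(** A sublocale is closed under meets, so that its binary meets are those of
the ambient frame. *)
Lemma sublocale_infimums2 x y m :
  infimums [set x; y] m <-> infimums [set val x; val y] (val m).
Proof.
split=> [|/infimums2P xym]; last by apply/infimums2P => z; rewrite -!Order.le_val xym.
have [k xyk] := frame_meet FL (val x) (val y).
have Sk : S k by apply: subS.1 xyk => _ [->|->]; apply: subposetS.
suff xyk' : infimums [set x; y] (Sub k (mem_set Sk)).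
  by move/(is_subset1_infimums xyk') <-; rewrite SubK.
by move/infimums2P: xyk => xyk; apply/infimums2P => z; rewrite -!Order.le_val SubK.
Qed.

Lemma sublocale_supremum G : exists s, supremums G s.
Proof.
pose ubG := [set u : L | S u /\ forall y, G y -> val y <= u].
have [k ubk] := frame_infimum FL ubG.
have Sk : S k by apply: subS.1 ubk => u [].
move/infimumsP: ubk => kP.
exists (Sub k (mem_set Sk)); split=> [y Gy|z ubz]; rewrite -Order.le_val SubK.
  by apply/kP => u [_]; apply.
apply: (iffLR (kP k)) => //; split; first exact: subposetS.
by move=> y /ubz; rewrite -Order.le_val.
Qed.

(** Joins in [S] differ from those of [L], so distributivity is not inherited
directly.  Instead, an upper bound [w] in [S] of the [x `&` y], [y] in [G],
gives the implication [x -> w], which lies in [S] and bounds [G], hence bounds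
the join of [G] in [S]. *)
Lemma sublocale_frame : is_frame (subposet S).
Proof.
split=> [|x G s m Gs xsm]; first exact: sublocale_supremum.
move/infimums2P: (xsm) => xsmP.
split=> [k [y Gy /infimums2P xyk]|w ubw].
  have [kx ky] := (xyk k).1 (lexx k).
  by apply/xsmP; split=> //; apply: le_trans ky (Gs.1 _ Gy).
have [i xwi] := frame_implication FL (val x) (val w).
have Si : S i by apply: subS.2 xwi; apply: subposetS.
have si : s <= Sub i (mem_set Si).
  apply: Gs.2 => y Gy; rewrite -Order.le_val SubK.
  have [k yxk] := frame_meet FL (val y) (val x).
  have Sk : S k by apply: subS.1 yxk => _ [->|->]; apply: subposetS.
  apply/(implication_le xwi yxk).
  have := ubw (Sub k (mem_set Sk)); rewrite -Order.le_val SubK; apply; exists y => //.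
  by apply/infimums2C/sublocale_infimums2; rewrite SubK.
move: si; rewrite -!Order.le_val SubK.
exact: (implication_le xwi (iffLR (sublocale_infimums2 _ _ _) (infimums2C xsm))).1.
Qed.

End Sublocale.

(** * Principal downsets and D-ideals *)

Section Dideals.
Context {d : Order.disp_t} {A : meetSemilatticeType d}.
Implicit Types (a b : A) (G : set A) (U V W : downsets A).

Lemma principal_le a U : principal a <= U <-> val U a.
Proof.
split=> [/downsets_leP|Ua]; first by apply; rewrite SubK /=.
by apply/downsets_leP; rewrite SubK => b /= ba; apply: downsetP ba Ua.
Qed.

Lemma principal_mono a b : (principal a <= principal b) = (a <= b).
Proof. by apply/idP/idP => [/principal_le|ab]; [|apply/principal_le]; rewrite SubK. Qed.

Lemma downset_eqP U V : (forall a, val U a <-> val V a) -> U = V.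
Proof. by move=> UV; apply/val_inj/seteqP; split=> a /UV. Qed.

Lemma downset_infimums (F : set (downsets A)) M : infimums F M ->
  forall a, val M a <-> (forall U, F U -> val U a).
Proof.
move=> /infimumsP FM a; rewrite -principal_le FM.
by split=> aF U /aF /principal_le.
Qed.

(** Testing [b] in [U] instead of [b <= a] in [U] suffices because [A] has
binary meets and [U] is a downset. *)
Lemma downset_implication U V W : is_implication U V W ->
  forall a, val W a <-> (forall b, val U b -> val V (a `&` b)).
Proof.
move=> UVW a; rewrite -principal_le.
rewrite (implication_le UVW (downset_meetP _ _)) downsets_leP !SubK.
split=> [UV b Ub|UV b [/= ba Ub]].
  by apply: UV; split; [exact: leIl|apply: downsetP Ub; exact: leIr].
by rewrite -(meet_r ba); apply: UV.
Qed.

Lemma principal_meetP a b :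
  infimums [set principal a; principal b] (principal (a `&` b)).
Proof.
apply/infimums2P => U; split=> [Uab|[/downsets_leP Ua /downsets_leP Ub]].
  by split; apply: le_trans Uab _; rewrite principal_mono ?leIl ?leIr.
apply/downsets_leP => c Uc; move: (Ua c Uc) (Ub c Uc); rewrite !SubK /=.
by rewrite lexI => -> ->.
Qed.

Lemma principal_Dideal a : @D_infty d A (principal a).
Proof.
split=> [|G s _ Ga Gs]; first exact: downsetP.
by rewrite SubK; apply: Gs.2 => y /Ga; rewrite SubK.
Qed.

Lemma admissible_distr {G s} : admissible G -> supremums G s ->
  forall a, supremums [set a `&` y | y in G] (a `&` s).
Proof. by move=> [t Gt dG] Gs; rewrite (is_subset1_supremums Gs Gt). Qed.

(** Admissibility quantifies over all multipliers, so it survives a further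
meet: meeting with [b] after [a] is meeting once with [b `&` a]. *)
Lemma admissible_meet {G} a :
  admissible G -> admissible [set a `&` y | y in G].
Proof.
case=> s Gs dG; exists (a `&` s) => // b.
rewrite image_comp (_ : _ @` _ = [set (b `&` a) `&` y | y in G]).
  by rewrite meetA.
by apply: eq_imagel => y _ /=; rewrite meetA.
Qed.

Lemma D_infty_sublocale : is_sublocale (@D_infty d A).
Proof.
split=> [F M FD /downset_infimums MF|U V W [dV VD] /downset_implication UVW].
  split=> [|G s aG GM Gs]; first exact: downsetP.
  apply/MF => U FU; have [_] := FD U FU; apply; [exact: aG| |exact: Gs].
  by move=> y /GM/MF; apply.
split=> [|G s aG GW Gs]; first exact: downsetP.
apply/UVW => b Ub; rewrite meetC.
apply: VD _ _ (admissible_meet b aG) _ (admissible_distr aG Gs b).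
by move=> _ [y Gy <-]; rewrite meetC; apply: (UVW y).1 => //; apply: GW.
Qed.

End Dideals.

(** * Sublocales above the D-ideals *)

Section Above.
Context {d : Order.disp_t} {A : meetSemilatticeType d} {S : set (downsets A)}.
Hypotheses (DS : @D_infty d A `<=` S).

Definition principal_in (a : A) : subposet S :=
  Sub (principal a) (mem_set (DS _ (principal_Dideal a))).

Lemma val_principal_in a : val (principal_in a) = principal a.
Proof. by rewrite SubK. Qed.

Lemma principal_in_Sbase : is_Sbase principal_in.
Proof.
split=> [a b|U|a b].
- by rewrite -Order.le_val !val_principal_in principal_mono.
- exists [set principal_in a | a in val (val U)]; first by move=> _ [a _ <-]; exists a.
  apply/supremumsP => V; rewrite -Order.le_val downsets_leP; split=> [UV _ [a Ua <-]|UV a Ua].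
    by rewrite -Order.le_val val_principal_in; apply/principal_le/UV.
  apply/principal_le; rewrite -val_principal_in Order.le_val.
  by apply: UV; exists a.
- have /infimums2P ab := principal_meetP a b.
  by apply/infimums2P => V; rewrite -!Order.le_val !val_principal_in !Order.le_val.
Qed.

End Above.

(** * The copy of a frame with a given S-base *)

Section CopyFrame.
Context {d d' : Order.disp_t} {A : meetSemilatticeType d} {L : porderType d'}
  {e : A -> L}.
Hypotheses (FL : is_frame L) (Se : is_Sbase e).

Lemma Sbase_mono a b : (e a <= e b) = (a <= b).
Proof. by case: Se. Qed.

Lemma Sbase_meet a b : infimums [set e a; e b] (e (a `&` b)).
Proof. by case: Se. Qed.

Lemma val_trace x a : val (trace Se x) a <-> e a <= x.
Proof. by rewrite SubK. Qed.

(** Distributivity of [L] over the joins of basic elements, with the binary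
meets computed in [A]. *)
Lemma Sbase_distr {V : set A} {v a m} :
  supremums (e @` V) v -> infimums [set e a; v] m ->
  forall w, m <= w <-> (forall b, V b -> e (a `&` b) <= w).
Proof.
move=> Vv avm w; rewrite (frame_meet_sup_le FL Vv avm); split=> [ub b Vb|ub].
  by apply: ub (Sbase_meet a b); exists b.
move=> _ k [b Vb <-] abk.
by rewrite (is_subset1_infimums abk (Sbase_meet a b)); apply: ub.
Qed.

Lemma copy_sublocale : is_sublocale (copy Se).
Proof.
split=> [F M Fc /downset_infimums MF|V T W [y _ <-] /downset_implication VyW].
  have [x /infimumsP xP] := frame_infimum FL [set x | F (trace Se x)].
  exists x => //; apply: downset_eqP => a; rewrite val_trace xP MF.
  split=> [ax U FU|aF z Fz]; last exact/val_trace/(aF _ Fz).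
  by have [z _ zU] := Fc U FU; rewrite -zU; apply/val_trace/ax; rewrite /= zU.
have [v Vv] := FL.1 (e @` val V).
have [i vyi] := frame_implication FL v y.
exists i => //; apply: downset_eqP => a; rewrite val_trace VyW.
have [m avm] := frame_meet FL (e a) v.
rewrite (implication_le vyi avm) (Sbase_distr Vv avm).
by split=> aV b /aV /val_trace.
Qed.

(** Elements of [A] below the join in [L] of a subset of [A] are distributive
joins already in [A]. *)
Lemma Sbase_supremums {V : set A} {v a} : supremums (e @` V) v -> e a <= v ->
  supremums [set a `&` b | b in V] a.
Proof.
move=> Vv av; have eaP : infimums [set e a; v] (e a).
  by apply/infimums2P => z; split=> [za|[]//]; split=> //; apply: le_trans av.
apply/supremumsP => c; rewrite -Sbase_mono (Sbase_distr Vv eaP).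
split=> [ub _ [b Vb <-]|ub b Vb]; first by rewrite -Sbase_mono; apply: ub.
by rewrite Sbase_mono; apply: ub; exists b.
Qed.

Lemma Sbase_admissible {V : set A} {v a} : supremums (e @` V) v -> e a <= v ->
  admissible [set a `&` b | b in V].
Proof.
move=> Vv av; exists a; first exact: Sbase_supremums av.
move=> c; rewrite image_comp (_ : _ @` _ = [set (c `&` a) `&` b | b in V]).
  apply: Sbase_supremums Vv _; apply: le_trans av.
  by rewrite Sbase_mono leIr.
by apply: eq_imagel => b _ /=; rewrite meetA.
Qed.

(** The element of [L] whose trace is a D-ideal is its join in [L]: whatever
basic element that join captures is already forced into the D-ideal by an
admissible subset of it. *)
Lemma Dideal_copy : @D_infty d A `<=` copy Se.
Proof.
move=> U [_ UD]; have [x Ux] := FL.1 (e @` val U).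
exists x => //; apply: downset_eqP => a; rewrite val_trace.
split=> [ax|Ua]; last by apply: Ux.1; exists a.
apply: UD _ _ (Sbase_admissible Ux ax) _ (Sbase_supremums Ux ax).
by move=> _ [b Ub <-]; apply: downsetP Ub; exact: leIr.
Qed.

End CopyFrame.

Theorem theorem3p6 (d : Order.disp_t) (A : meetSemilatticeType d) :
  [/\ is_sublocale (@D_infty d A),
      forall S : set (downsets A),
        sublocale_interval (@D_infty d A) setT S ->
        is_frame (subposet S) /\
        exists e : A -> subposet S,
          (forall a : A, val (e a) = principal a) /\ is_Sbase e
    & forall (d' : Order.disp_t) (L : porderType d') (e : A -> L),
        is_frame L ->
        forall Se : is_Sbase e,
          sublocale_interval (@D_infty d A) setT (copy Se)].
Proof.
split=> [|S [subS DS _]|d' L e FL Se]; first exact: D_infty_sublocale.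
  split; first exact: sublocale_frame (downsets_frame A) subS.
  exists (principal_in DS); split; first exact: val_principal_in.
  exact: principal_in_Sbase.
by split=> //; [exact: copy_sublocale|exact: Dideal_copy].
Qed.
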